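(* Let $\alpha\in(0,1)$ and let $u_\alpha(k)$, $k\ge1$, be either the linear boundary $u_\alpha(k)=\sqrt{\frac{-\log\alpha}{2m}}\,k+\sqrt{\frac{-m\log\alpha}{2}}$ (for a fixed $m>0$) or the curved boundary $u_\alpha(k)=1.7\sqrt{k(\log\log(2k)+0.72\log\frac{5.2}{\alpha})}$. Let $(p_i)_{i\in\mathcal I}$ be $p$-values and $(x_i)_{i\in\mathcal I}$ covariates, and suppose the $p$-values are mirror-conservative, mutually independent, and independent of the covariates. Then, regardless of how the analyst's choices below are made (subject only to the stated measurability), the interactively ordered martingale test rejects with probability at most $\alpha$, in both of the following versions. (Batch version, $\mathcal I=\{1,\dots,n\}$.) Set $M_0=\emptyset$ and $\mathcal F_0=\sigma((x_i,g(p_i))_{i=1}^n)$. For $k=1,\dots,n$: choose $i^\star_k\in\{1,\dots,n\}\setminus M_{k-1}$ measurably with respect to $\mathcal F_{k-1}$, set $M_k=M_{k-1}\cup\{i^\star_k\}$ and $\mathcal F_k=\sigma((x_i,g(p_i))_{i=1}^n,(p_i)_{i\in M_k})$; reject the global null if $\sum_{i\in M_k}h(p_i)>u_\alpha(k)$. (Online version, $\mathcal I=\mathbb N$.) Set $M_0=\emptyset$, $k=0$. For $t=1,2,\dots$: let $\mathcal F_{t-1}=\sigma((x_i,g(p_i))_{i=1}^t,(p_i)_{i=1}^{t-1})$; decide, measurably with respect to $\mathcal F_{t-1}$, whether to include hypothesis $t$; if included, set $k\leftarrow k+1$ and $M_k=M_{k-1}\cup\{t\}$; reject the global null if $k\ge1$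 and $\sum_{i\in M_k}h(p_i)>u_\alpha(k)$.
   Context: For a $p$-value $p$ define the missing bit $h(p)=2\cdot\mathbf 1\{p<0.5\}-1\in\{-1,1\}$ and the masked $p$-value $g(p)=\min\{p,1-p\}$. A $p$-value $p_i$ with probability mass function (if discrete) or density (otherwise) $f_i$ is mirror-conservative if $f_i(a)\le f_i(1-a)$ for all $0\le a\le0.5$. The stated assumptions describe the global null hypothesis, and the probability of rejection under them is the type-I error. *)

(* Defs.v *)
From HB Require Import structures.
From mathcomp Require Import all_boot all_order all_algebra.
From mathcomp Require Import all_classical all_reals all_analysis.
Set Implicit Arguments. Unset Strict Implicit. Unset Printing Implicit Defensive.
Import Order.TTheory GRing.Theory Num.Theory.
Local Open Scope classical_set_scope.
Local Open Scope ring_scope.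

Section Defs.
Variable R : realType.

Definition hbit (p : R) : R := if p < 2^-1 then 1 else -1.
Definition gmask (p : R) : R := Num.min p (1 - p).

Definition linear_boundary (m alpha : R) (k : nat) : R :=
  Num.sqrt (- ln alpha / (2 * m)) * k%:R + Num.sqrt (- (m * ln alpha) / 2).
Definition curved_boundary (alpha : R) (k : nat) : R :=
  (17 / 10) * Num.sqrt (k%:R * (ln (ln (2 * k%:R)) + (72 / 100) * ln ((52 / 10) / alpha))).

Variables (d : measure_display) (T : measurableType d) (P : probability T R).

Definition sigmaR (X : T -> R) : set (set T) :=
  [set A | exists B : set R, measurable B /\ A = X @^-1` B].

Definition sigma_family (I : Type) (dX : measure_display) (X : measurableType dX)
  (x : I -> T -> X) : set (set T) :=
  <<s [set A | exists i (B : set X), measurable B /\ A = x i @^-1` B] >>.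

Definition mirror_conservative (X : T -> R) : Prop :=
  (exists S : set R, countable S /\ P (X @^-1` S) = 1%E /\
     forall a : R, 0 <= a <= 2^-1 ->
       (P (X @^-1` [set a]) <= P (X @^-1` [set (1 - a)%R]))%E)
  \/
  (exists f : R -> R, (forall a, 0 <= f a) /\ measurable_fun setT f /\
     (forall A : set R, measurable A ->
        P (X @^-1` A) = (\int[lebesgue_measure]_(a in A) (f a)%:E)%E) /\
     forall a : R, 0 <= a <= 2^-1 -> f a <= f (1 - a)).

Definition mutually_independent (I : eqType) (F : I -> set (set T)) : Prop :=
  forall (J : seq I) (A : I -> set T), uniq J ->
    (forall i, i \in J -> F i (A i)) ->
    P (\bigcap_(i in [set` J]) A i) = (\prod_(i <- J) P (A i))%E.

End Defs.

Section Batch.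
Variables (R : realType) (d : measure_display) (T : measurableType d).
Variables (dX : measure_display) (X : measurableType dX) (n : nat).
Variables (x : 'I_n -> T -> X) (p : 'I_n -> T -> R) (istar : nat -> T -> 'I_n).

Definition inM (k : nat) (w : T) (i : 'I_n) : bool :=
  [exists j : 'I_k, istar j.+1 w == i].

Definition Fbatch (k : nat) : set (set T) :=
  <<s [set A | (exists i (B : set X), measurable B /\ A = x i @^-1` B)
            \/ (exists i (B : set R), measurable B /\
                  A = (fun w => gmask (p i w)) @^-1` B)
            \/ (exists i (B : set R), measurable B /\
                  A = [set w | inM k w i /\ B (p i w)])] >>.

Definition Sbatch (k : nat) (w : T) : R := \sum_(i | inM k w i) hbit (p i w).
End Batch.

Section Online.
Variables (R : realType) (d : measure_display) (T : measurableType d).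
Variables (dX : measure_display) (X : measurableType dX).
Variables (x : nat -> T -> X) (p : nat -> T -> R) (incl : nat -> T -> bool).

(* hypotheses are indexed 0,1,2,... (paper's t = our t+1).
   Fonline t = sigma((x_i, g(p_i))_{i <= t}, (p_i)_{i < t}), the information
   available when deciding whether to include hypothesis t. *)
Definition Fonline (t : nat) : set (set T) :=
  <<s [set A | (exists i (B : set X), (i <= t)%N /\ measurable B /\ A = x i @^-1` B)
            \/ (exists i (B : set R), (i <= t)%N /\ measurable B /\
                  A = (fun w => gmask (p i w)) @^-1` B)
            \/ (exists i (B : set R), (i < t)%N /\ measurable B /\
                  A = p i @^-1` B)] >>.

Definition Konline (t : nat) (w : T) : nat := \sum_(s < t.+1) (incl s w : nat).
Definition Sonline (t : nat) (w : T) : R :=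
  \sum_(s < t.+1 | incl s w) hbit (p s w).
End Online.

(* Main.v *)
(* Mirror-conservativeness says that, given the masked value of [p i], the missing
   bit is [1] with probability at most [1/2].  By independence this persists
   given everything the analyst knows while [p i] is masked: [p i] and the
   remaining data have a product law, and the inequality holds section by
   section.  Hence the running sum [S] of the bits, observed after [K]
   selections, is a game with at most fair odds against [h = 1], so that
   [expR (lam * S - lam ^+ 2 / 2 * K)] is a supermartingale and Ville's
   inequality bounds by [expR (- L)] the probability that [S] ever crosses the
   line [k |-> L / lam + lam / 2 * k].  The linear boundary is one such line; the
   curved one lies above one line on each dyadic epoch, and the errors
   [expR (- L)] of these lines add up to at most [alpha]. *)

Require Import Defs.
From HB Require Import structures.
From mathcomp Require Import all_boot all_order all_algebra.
From mathcomp Require Import all_classical all_reals all_analysis.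
From mathcomp Require Import measurable_realfun ring lra.
Import Order.TTheory GRing.Theory Num.Theory.
Local Open Scope classical_set_scope.
Local Open Scope ring_scope.
Set Implicit Arguments. Unset Strict Implicit. Unset Printing Implicit Defensive.

(** * Hoeffding's bound for a fair sign *)

Section cosh.
Import numFieldNormedType.Exports.

(** [g], the left-hand side times [expR (- (y ^+ 2 / 2))], equals 2 at 0 and is nonincreasing on the
    half-line: its derivative has the sign of [- h], while [h 0 = 0] and [h] has the derivative
    [y * (expR y - expR (- y)) >= 0]. *)
Lemma expR_cosh_le (R : realType) (x : R) : 0 <= x ->
  expR x + expR (- x) <= 2 * expR (x ^+ 2 / 2).
Proof.
move=> x0.
pose h (y : R) := (1 + y) * expR (- y) - (1 - y) * expR y.
have dh y : is_derive y (1:R) h (y * expR y - y * expR (- y)).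
  by apply: is_derive_eq; rewrite /GRing.scale/=; ring.
have h0 y : 0 <= y -> 0 <= h y.
  move=> y0; have -> : 0 = h 0 by rewrite /h oppr0 expR0; ring.
  apply: (@ger0_derive1_ndecry _ _ 0) => //.
  - move=> z; rewrite in_itv/= andbT => z0; rewrite derive1E; have [_ ->] := dh z.
    by rewrite -mulrBr mulr_ge0 ?(ltW z0)// subr_ge0 ler_expR; lra.
  - apply: continuous_subspaceT => z.
    exact/differentiable_continuous/derivable1_diffP.
pose g (y : R) := expR (y - y ^+ 2 / 2) + expR (- y - y ^+ 2 / 2).
have dg y : is_derive y (1:R) g (- (expR (- (y ^+ 2 / 2)) * h y)).
  by apply: is_derive_eq; rewrite /h !expRD /GRing.scale/=; field.
have : g x <= g 0.
  apply: (@ler0_derive1_nincry _ _ 0) => //.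
  - move=> z; rewrite in_itv/= andbT => z0; rewrite derive1E; have [_ ->] := dg z.
    by rewrite oppr_le0 mulr_ge0 ?expR_ge0 ?h0 ?ltW.
  - apply: continuous_subspaceT => z.
    exact/differentiable_continuous/derivable1_diffP.
rewrite /g !expRD -mulrDl [X in _ * X <= _]expRN ler_pdivrMr ?expR_gt0//.
by rewrite expr0n/= mul0r oppr0 expR0 !mulr1.
Qed.

End cosh.

(** * Lines below the boundaries *)

Section boundaries.
Variable R : realType.

(** The bound [1 + x <= expR x] at -2/25 gives [expR (2 / 25) <= 25 / 23], and (25/23)^8 is still
    below 2. *)
Lemma ln2_ge : 16 / 25 <= ln (2 : R).
Proof.
rewrite -ler_expR lnK ?posrE//.
have -> : (16 / 25 : R) = 8%:R * (2 / 25) by field.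
have e : expR (2 / 25 : R) <= 25 / 23.
  have := expR_ge1Dx (- (2 / 25) : R); have := expR_gt0 (2 / 25 : R).
  move=> e0; rewrite expRN -[(expR _)^-1]div1r ler_pdivlMr// => h; lra.
rewrite expRM_natl; apply: (@le_trans _ _ ((25 / 23) ^+ 8)).
  by rewrite lerXn2r// nnegrE ?expR_ge0//; lra.
by rewrite expr_div_n ler_pdivrMr ?exprn_gt0//; lra.
Qed.

(** 16/25 is the inverse square of 5/4, and [ln (5 / 4) <= 1 / 4]. *)
Lemma lnln2_ge : - (1 / 2) <= ln (ln (2 : R)).
Proof.
have l2 := ln2_ge.
have h : ln ((5 / 4 : R) ^+ 2) <= 1 / 2.
  rewrite lnXn; last by lra.
  have := @le_ln1Dx R (1 / 4); rewrite (_ : 1 + 1 / 4 = 5 / 4); last by field.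
  move=> /(_ _)/wrap[]; first by lra.
  by move=> ?; rewrite mulr2n; lra.
apply: (@le_trans _ _ (ln (((5 / 4 : R) ^+ 2)^-1))).
  by rewrite lnV ?posrE ?exprn_gt0//; lra.
rewrite ler_ln ?posrE ?invr_gt0 ?exprn_gt0//; lra.
Qed.

(* Two uses of [1 + x <= expR x] give
   [m ^ -s <= ((m - 1) ^ (1 - s) - m ^ (1 - s)) / (s - 1)]. *)
Lemma zeta_telescope (s : R) (m : nat) : 1 < s -> (1 < m)%N ->
  expR (- (s * ln m%:R)) <=
  (expR ((1 - s) * ln m.-1%:R) - expR ((1 - s) * ln m%:R)) / (s - 1).
Proof.
move=> s1 m1.
have m0 : 0 < m%:R :> R by rewrite ltr0n ltnW.
have m10 : 0 < m.-1%:R :> R by rewrite ltr0n -subn1 subn_gt0.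
have mE : m.-1%:R = m%:R - 1 :> R by rewrite -subn1 natrB// ltnW.
rewrite ler_pdivlMr ?subr_gt0//.
have -> : expR ((1 - s) * ln m.-1%:R) =
    expR ((1 - s) * ln m%:R) * expR ((s - 1) * ln (m%:R / m.-1%:R)).
  by rewrite -expRD ln_div ?posrE//; congr expR; ring.
have -> : expR (- (s * ln m%:R)) = expR ((1 - s) * ln m%:R) / m%:R.
  rewrite -[X in _ / X]lnK ?posrE// -expRN -expRD; congr expR; ring.
rewrite -[X in _ <= _ - X]mulr1 -mulrBr -mulrA ler_pM2l ?expR_gt0//.
have h : m%:R^-1 <= ln (m%:R / m.-1%:R : R).
  have E : m.-1%:R / m%:R = 1 + - m%:R^-1 :> R by rewrite mE; field; rewrite gt_eqF.
  have h := @le_ln1Dx R (- m%:R^-1); rewrite -E in h.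
  rewrite -[m%:R / _]invf_div lnV ?posrE ?divr_gt0// lerNr; apply: h.
  by rewrite ltrN2 invf_lt1// ltr1n.
have := expR_ge1Dx ((s - 1) * ln (m%:R / m.-1%:R)).
have : (s - 1) / m%:R <= (s - 1) * ln (m%:R / m.-1%:R).
  by rewrite ler_pM2l ?subr_gt0.
rewrite [m%:R^-1 * _]mulrC; lra.
Qed.

Lemma zeta_tail_le (s : R) (n : nat) : 1 < s ->
  \sum_(j < n) expR (- (s * ln (j + 3)%:R)) <= expR ((1 - s) * ln 2) / (s - 1).
Proof.
move=> s1; have s0 : 0 < s - 1 by rewrite subr_gt0.
(* The induction must carry the negative end term of the telescoping sum. *)
suff : \sum_(j < n) expR (- (s * ln (j + 3)%:R)) <=
    (expR ((1 - s) * ln 2) - expR ((1 - s) * ln (n + 2)%:R)) / (s - 1).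
  move=> h; apply: (le_trans h).
  by rewrite ler_pM2r ?invr_gt0// gerBl expR_ge0.
elim: n => [|n IH]; first by rewrite big_ord0 add0n subrr mul0r.
rewrite big_ord_recr/=; apply: (le_trans (lerD IH (zeta_telescope s1 _))).
  by rewrite addn3.
by rewrite -mulrDl addn3 addSn addn2/= addrA subrK.
Qed.

(* In the [j]-th line of the family, [L j <= lam j * s - lam j ^+ 2 / 2 * k]
   means [s >= L j / lam j + lam j / 2 * k]; under the null this line is ever
   crossed with probability at most [expR (- L j)]. *)
Definition lines_below (u : nat -> R) (alpha : R) := forall n,
  exists J (lam L : nat -> R),
     [/\ forall j, 0 <= lam j, \sum_(j < J) expR (- L j) <= alpha &
      forall k s, (0 < k <= n)%N -> s <= k%:R -> u k < s ->
        exists2 j, (j < J)%N & L j <= lam j * s - lam j ^+ 2 / 2 * k%:R].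

(** The boundary is itself a line of the family: its intercept is [m] times its slope [b], and
    [lam = 2 * b], [L = 2 * m * b ^+ 2] give [L / lam = m * b]. *)
Lemma linear_boundary_lines (alpha m : R) : 0 < alpha < 1 -> 0 < m ->
  lines_below (linear_boundary m alpha) alpha.
Proof.
move=> /andP[a0 a1] m0 n; set L := - ln alpha.
have L0 : 0 < L by rewrite oppr_gt0 ln_lt0// a0.
pose b := Num.sqrt (L / (2 * m)).
have b0 : 0 < b by rewrite sqrtr_gt0 divr_gt0// mulr_gt0.
have b2 : b ^+ 2 = L / (2 * m) by rewrite sqr_sqrtr// ltW// divr_gt0// mulr_gt0.
have cE : Num.sqrt (- (m * ln alpha) / 2) = m * b.
  rewrite -mulrN -/L -[m in RHS]gtr0_norm// -sqrtr_sqr -sqrtrM ?sqr_ge0//.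
  by congr Num.sqrt; field; rewrite gt_eqF.
exists 1%N, (fun=> 2 * b), (fun=> L); split.
- by move=> _; rewrite mulr_ge0// ltW.
- by rewrite big_ord1 opprK lnK ?posrE.
- move=> k s _ _; rewrite /linear_boundary cE -/L -/b => us; exists 0%N => //.
  have LE : L = b ^+ 2 * (2 * m) by rewrite b2; field; rewrite gt_eqF.
  rewrite LE.
  have : 0 < b * (s - (b * k%:R + m * b)) by rewrite mulr_gt0// subr_gt0.
  nra.
Qed.

(* Stitching: on the dyadic epoch [N <= k <= 2 N] a single line lies below the
   curve; its slope corresponds to [lam ^+ 2 = 2 L / (7/5 N)], [7/5] standing for
   the optimal [sqrt 2]. *)
Lemma epoch_line (L N k v s : R) : 0 < L -> 0 < N -> N <= k <= 2 * N ->
  L <= v * (25 / 18) -> 17 / 10 * Num.sqrt (k * v) < s ->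
  L <= Num.sqrt (10 * L / (7 * N)) * s - Num.sqrt (10 * L / (7 * N)) ^+ 2 / 2 * k.
Proof.
move=> L0 N0 /andP[Nk kN] Lv us.
have k0 : 0 < k by lra.
have q0 : 0 < 10 * L / (7 * N) by rewrite divr_gt0// mulr_gt0.
set lam := Num.sqrt _; have lam0 : 0 < lam by rewrite sqrtr_gt0.
have lam2 : lam ^+ 2 = 10 * L / (7 * N) by rewrite sqr_sqrtr// ltW.
have v0 : 0 < v by lra.
have kv0 : 0 < k * v by rewrite mulr_gt0.
set u := 17 / 10 * _ in us; have u0 : 0 <= u by rewrite mulr_ge0// sqrtr_ge0.
have u2 : u ^+ 2 = 289 / 100 * (k * v) by rewrite exprMn sqr_sqrtr ?ltW//; field.
suff h : L + lam ^+ 2 / 2 * k <= lam * u.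
  by rewrite lerBrDr (le_trans h)// ler_pM2l// ltW.
have l0 : 0 <= L + lam ^+ 2 / 2 * k.
  by rewrite addr_ge0 ?ltW// !mulr_gt0// ?exprn_gt0.
rewrite -ler_sqr ?nnegrE ?mulr_ge0 ?(ltW lam0)// exprMn u2 lam2.
have -> : (L + 10 * L / (7 * N) / 2 * k) ^+ 2 =
    L ^+ 2 * ((7 * N + 5 * k) ^+ 2 / (49 * N ^+ 2)).
  by field; rewrite gt_eqF.
(* On the epoch [(k - N) * (2 * N - k) >= 0], hence [(7 * N + 5 * k) ^+ 2 <= 145 * (N * k)]. The
   slightly larger 728/5 produces the factor 208/289 below, which is less than 18/25. *)
apply: (@le_trans _ _ (L ^+ 2 * (728 / 5 * (N * k) / (49 * N ^+ 2)))).
  rewrite ler_pM2l ?exprn_gt0// ler_pM2r ?invr_gt0 ?mulr_gt0 ?exprn_gt0//.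
  have : 0 <= (k - N) * (2 * N - k) by apply: mulr_ge0; rewrite subr_ge0.
  have : 0 < N * k by rewrite mulr_gt0.
  nra.
have -> : L ^+ 2 * (728 / 5 * (N * k) / (49 * N ^+ 2)) =
    10 * L / (7 * N) * (289 / 100 * k) * (L * (208 / 289)).
  by field; rewrite gt_eqF.
have -> : 10 * L / (7 * N) * (289 / 100 * (k * v)) =
    10 * L / (7 * N) * (289 / 100 * k) * v.
  by ring.
have q1 : 0 < 10 * L / (7 * N) * (289 / 100 * k) by rewrite mulr_gt0// mulr_gt0.
by rewrite ler_pM2l//; lra.
Qed.

(* The first two epochs are dropped from the union bound: the score is at most
   [k] and the curve starts above the diagonal. *)
Lemma curved_boundary_ge (alpha : R) (k : nat) : 0 < alpha < 1 -> (0 < k < 4)%N ->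
  k%:R <= curved_boundary alpha k.
Proof.
move=> /andP[a0 a1] k14.
have B0 : 32 / 25 <= ln ((52 / 10) / alpha).
  apply: (@le_trans _ _ (ln ((2 : R) ^+ 2))).
    by rewrite lnXn// mulr2n; have := ln2_ge; lra.
  rewrite ler_ln ?posrE ?exprn_gt0 ?divr_gt0//.
  by rewrite ler_pdivlMr//; nra.
have kV (v : R) : k%:R <= 289 / 100 * v -> k%:R <= 17 / 10 * Num.sqrt (k%:R * v).
  move=> h; have k0 : 0 < k%:R :> R by case/andP: k14; rewrite ltr0n.
  have v0 : 0 < v by lra.
  rewrite -ler_sqr ?nnegrE ?mulr_ge0 ?sqrtr_ge0 ?(ltW k0)//.
  rewrite exprMn sqr_sqrtr ?mulr_ge0 ?(ltW k0) ?(ltW v0)// expr2.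
  have -> : (17 / 10) ^+ 2 * (k%:R * v) = k%:R * (289 / 100 * v) by field.
  by rewrite ler_pM2l.
(* This value serves for [k = 2] and, by monotonicity, for [k = 3]; [k = 1] relies on [lnln2_ge]. *)
have l4 : 21 / 100 <= ln (ln (4 : R)).
  have e4 : 32 / 25 <= ln (4 : R).
    have -> : 4 = 2 ^+ 2 :> R by ring.
    by rewrite lnXn// mulr2n; have := ln2_ge; lra.
  apply: (@le_trans _ _ (ln (32 / 25))); last by rewrite ler_ln ?posrE//; lra.
  rewrite -[32 / 25]invf_div lnV ?posrE; last lra.
  have := @le_ln1Dx R (- (7 / 32)); have -> : 1 + - (7 / 32) = 25 / 32 :> R by field.
  by move=> /(_ ltac:(lra)); lra.
rewrite /curved_boundary; apply: kV.
case: k k14 => [//|[|[|[|//]]]] _ /=.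
- have l2 := lnln2_ge; rewrite (_ : 2 * 1 = 2); last by ring.
  lra.
- rewrite (_ : 2 * 2 = 4); last by ring.
  lra.
- have : ln (ln (4 : R)) <= ln (ln (2 * 3)).
    rewrite ler_ln ?posrE ?ln_gt0//; try lra.
    by rewrite ler_ln ?posrE//; lra.
  lra.
Qed.

(* [25/18 = 1/0.72] is the exponent that turns the summand [0.72 log (5.2 / alpha)]
   of the boundary into the factor [alpha / 5.2]; the resulting total error is
   [alpha * (2 * 18/7) / 5.2], which is just below [alpha]. *)
Lemma curved_boundary_lines (alpha : R) : 0 < alpha < 1 ->
  lines_below (curved_boundary alpha) alpha.
Proof.
move=> a01 n; have /andP[a0 a1] := a01.
have B0 : 0 < ln ((52 / 10) / alpha).
  by rewrite ln_gt0// ltr_pdivlMr//; lra.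
set B := ln ((52 / 10) / alpha) in B0.
(* Epoch [j] is [2 ^ (j + 2) <= k < 2 ^ (j + 3)]. There [ln (2 * k)] is at least [(j + 3) * ln 2],
   so 18/25 of [L j] is at most the factor of [k] under the root. *)
pose L (j : nat) := 25 / 18 * (ln (j + 3)%:R + ln (ln 2)) + B.
have l2 := ln2_ge; have ll2 := lnln2_ge.
have L0 j : 0 < L j.
  rewrite addr_gt0// mulr_gt0//.
  have : ln (2 : R) <= ln (j + 3)%:R.
    by rewrite ler_ln ?posrE ?ltr0n ?addn3// ler_nat.
  lra.
(* [n] epochs reach the horizon, since [j < 2 ^ (j + 2) <= k <= n]. *)
exists n, (fun j => Num.sqrt (10 * L j / (7 * 2 ^+ (j + 2)))), L; split.
- by move=> j; exact: sqrtr_ge0.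
- have EL j : expR (- L j) =
      expR (- (25 / 18 * ln (j + 3)%:R)) *
      (expR (- (25 / 18 * ln (ln 2))) * (alpha / (52 / 10))).
    rewrite -[alpha / _]invf_div -[X in _ * (_ * X^-1)]lnK ?posrE ?divr_gt0//.
    by rewrite -expRN -!expRD /L -/B; congr expR; ring.
  under eq_bigr do rewrite EL.
  rewrite -mulr_suml.
  apply: (@le_trans _ _ (expR ((1 - 25 / 18) * ln 2) / (25 / 18 - 1) *
     (expR (- (25 / 18 * ln (ln 2))) * (alpha / (52 / 10))))).
    rewrite ler_pM2r; first by apply: zeta_tail_le; lra.
    by rewrite mulr_gt0 ?expR_gt0// divr_gt0//; lra.
  have -> : expR ((1 - 25 / 18) * ln 2) / (25 / 18 - 1) *
     (expR (- (25 / 18 * ln (ln 2))) * (alpha / (52 / 10))) =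
     expR ((1 - 25 / 18) * ln 2 - 25 / 18 * ln (ln 2)) * alpha * (180 / 364).
    by rewrite expRD; field.
  (* With [ln (ln 2) >= - (1 / 2)] this reduces to [ln 2 >= 1 / 2]; the total is then
     [alpha * 360 / 364]. *)
  have : expR ((1 - 25 / 18) * ln 2 - 25 / 18 * ln (ln 2)) <= 2 :> R.
    rewrite -[leRHS]lnK ?posrE// ler_expR; lra.
  move: (expR _) => e e2; nra.
- move=> k s /andP[k0 kn] sk us.
  have k4 : (4 <= k)%N.
    rewrite leqNgt; apply/negP => k4.
    have := @curved_boundary_ge alpha k a01; rewrite k0 k4 => /(_ isT) ku.
    by move: (lt_le_trans us sk); rewrite ltNge ku.
  have /andP[t1 t2] := trunc_log_bounds (isT : (1 < 2)%N) k0.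
  have t3 : (2 <= trunc_log 2 k)%N by exact: trunc_log_max.
  pose j := (trunc_log 2 k - 2)%N.
  have jE : trunc_log 2 k = (j + 2)%N by rewrite subnK.
  rewrite jE in t1 t2.
  have NE : 2 ^+ (j + 2) = (2 ^ (j + 2))%:R :> R by rewrite natrX.
  exists j.
    apply: leq_trans kn; apply: leq_trans t1.
    by apply: (leq_ltn_trans (leq_addr 2 j)); exact: ltn_expl.
  apply: (@epoch_line _ _ _ (ln (ln (2 * k%:R)) + 72 / 100 * B)) => //.
  - by rewrite NE -natrM !ler_nat t1/= -expnS ltnW.
  - have : ln (j + 3)%:R + ln (ln 2) <= ln (ln (2 * k%:R)) :> R.
      have p0 : 0 < (j + 3)%:R :> R by rewrite ltr0n addn3.
      have q0 : 0 < ln 2 :> R by lra.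
      rewrite -lnM ?posrE//.
      have -> : (j + 3)%:R * ln 2 = ln (2 ^+ (j + 3)) :> R.
        by rewrite lnXn// mulr_natl.
      have h : 2 ^+ (j + 3) <= 2 * k%:R :> R.
        by rewrite addnS exprS ler_pM2l// NE ler_nat.
      have h1 : 1 < 2 ^+ (j + 3) :> R by rewrite exprn_egt1// ?addn3// ltr1n.
      rewrite ler_ln ?posrE ?ln_gt0 ?(lt_le_trans h1)// ler_ln// posrE; lra.
    rewrite /L; lra.
Qed.

End boundaries.

(** * Line crossing in an unfavourable game *)

Section gambling.
Context (R : realType) (d : measure_display) (T : measurableType d).
Variables (P : probability T R) (inc hd : nat -> T -> bool).

Definition rounds (t : nat) (w : T) : nat := (\sum_(s < t) inc s w)%N.
Definition gain (t : nat) (w : T) : R :=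
  \sum_(s < t | inc s w) (if hd s w then 1 else -1).

Lemma roundsS t w : rounds t.+1 w = (rounds t w + inc t w)%N.
Proof. by rewrite /rounds big_ord_recr. Qed.

Lemma gainS t w : gain t.+1 w =
  gain t w + (if inc t w then if hd t w then 1 else -1 else 0).
Proof. by rewrite /gain big_mkcond big_ord_recr/= -big_mkcond. Qed.

Lemma gain_le_rounds t w : gain t w <= (rounds t w)%:R.
Proof.
elim: t => [|t IH]; first by rewrite /gain /rounds !big_ord0.
rewrite gainS roundsS natrD lerD//; case: (inc t w) => //; case: (hd t w) => //.
by rewrite (le_trans _ (@ler0n _ 1))// oppr_le0.
Qed.

Definition wins t : set T := [set w | inc t w && hd t w].
Definition losses t : set T := [set w | inc t w && ~~ hd t w].
Definition skips t : set T := [set w | ~~ inc t w].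

(* [F t] is the class of events known before round [t]; it need not be a
   sigma-algebra. *)
Variable F : nat -> set (set T).
Hypotheses (F_measurable : forall t A, F t A -> measurable A)
  (F_setT : forall t, F t setT)
  (F_win : forall t A, F t A -> F t.+1 (A `&` wins t))
  (F_loss : forall t A, F t A -> F t.+1 (A `&` losses t))
  (F_skip : forall t A, F t A -> F t.+1 (A `&` skips t))
  (F_unfavourable : forall t A, F t A ->
     (P (A `&` wins t) <= P (A `&` losses t))%E).

(** [Q] may be arbitrary: before time [t] there are finitely many sequences of outcomes, each a
    measurable event. A win, loss or skip in the last round just shifts the arguments of [Q]. *)
Lemma measurable_rounds_gain (Q : nat -> R -> Prop) t :
  measurable [set w | Q (rounds t w) (gain t w)].
Proof.
have mw s : measurable (wins s).
  by rewrite -[X in measurable X]setTI; exact: F_measurable (F_win _).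
have ml s : measurable (losses s).
  by rewrite -[X in measurable X]setTI; exact: F_measurable (F_loss _).
have ms s : measurable (skips s).
  by rewrite -[X in measurable X]setTI; exact: F_measurable (F_skip _).
elim: t Q => [|t IH] Q.
  have [q|q] := pselect (Q 0%N 0).
    rewrite (_ : mkset _ = setT) //; apply/seteqP; split => // w _ /=.
    by rewrite /rounds /gain !big_ord0.
  rewrite (_ : mkset _ = set0) //; apply/seteqP; split => // w /=.
  by rewrite /rounds /gain !big_ord0.
rewrite (_ : mkset _ =
    (wins t `&` [set w | Q (rounds t w).+1 (gain t w + 1)]) `|`
    (losses t `&` [set w | Q (rounds t w).+1 (gain t w - 1)]) `|`
    (skips t `&` [set w | Q (rounds t w) (gain t w)])); last first.
  apply/seteqP; split => w; rewrite /wins /losses /skips/= roundsS gainS;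
    case: (inc t w); case: (hd t w) => //=; rewrite ?addn1 ?addn0 ?addr0;
    by intuition.
apply: measurableU; [apply: measurableU|]; apply: measurableI => //.
- exact: (IH (fun k s => Q k.+1 (s + 1))).
- exact: (IH (fun k s => Q k.+1 (s - 1))).
Qed.

(** The window is [t, ..., t + n - 1]; its start moves in the induction on the horizon. *)
Let crossing (lam L : R) n t :=
  [set w | exists2 r, (r < n)%N &
     L <= lam * gain (t + r) w - lam ^+ 2 / 2 * (rounds (t + r) w)%:R].

Let measurable_crossing lam L n t : measurable (crossing lam L n t).
Proof.
rewrite -[crossing _ _ _ _]/(\bigcup_(r in [set r | (r < n)%N]) _).
apply: bigcup_measurable => r _.
exact: (measurable_rounds_gain (fun k s => L <= lam * s - lam ^+ 2 / 2 * k%:R)).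
Qed.

(* Ville's inequality for [expR (lam * gain - lam ^+ 2 / 2 * rounds)], by
   induction on the horizon; conditioning on the past is replaced by
   restricting to the events of [F t]. *)
Lemma crossing_le lam L n t A k s : 0 <= lam -> F t A ->
  (forall w, A w -> rounds t w = k /\ gain t w = s) ->
  (P (A `&` crossing lam L n t) <=
   (expR (lam * s - lam ^+ 2 / 2 * k%:R - L))%:E * P A)%E.
Proof.
move=> lam0; elim: n t A k s => [|n IH] t A k s FA Aks.
  rewrite (_ : crossing _ _ _ _ = set0); last first.
    by apply/seteqP; split => // w [].
  by rewrite setI0 measure0 mule_ge0// lee_fin expR_ge0.
have mA := F_measurable FA.
(* If [c >= 0], the line is already crossed at time [t] and the bound is trivial, as [expR c >= 1].
   Otherwise any crossing comes later, after a win, a loss or a skip in round [t]. *)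
set c := _ - L; have [c0|c0] := leP 0 c.
  apply: (@le_trans _ _ (P A)).
    by apply: le_measure; rewrite ?inE//; exact: measurableI.
  rewrite -[leLHS]mul1e lee_wpmul2r// lee_fin.
  by rewrite (le_trans _ (expR_ge1Dx _))// lerDl.
have FW := F_win FA; have FL := F_loss FA; have FS := F_skip FA.
have mW := F_measurable FW; have mL := F_measurable FL; have mS := F_measurable FS.
have -> : A `&` crossing lam L n.+1 t =
    (A `&` wins t) `&` crossing lam L n t.+1 `|`
    (A `&` losses t) `&` crossing lam L n t.+1 `|`
    (A `&` skips t) `&` crossing lam L n t.+1.
  apply/seteqP; split => [w [Aw [[|r] rn]]|w].
  - rewrite addn0; have [-> ->] := Aks _ Aw => Ls.
    by move: c0; rewrite /c subr_lt0 ltNge Ls.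
  - rewrite addnS -addSn => Ls.
    have cr : crossing lam L n t.+1 w by exists r.
    by rewrite /wins /losses /skips/=; case: (inc t w); case: (hd t w);
      [left; left|left; right|right|right].
  - by move=> [[|]|] [[Aw _] [r rn Ls]]; split=> //; exists r.+1 => //;
      rewrite addnS -addSn.
have mC := measurable_crossing lam L n t.+1.
apply: (le_trans (measureU2 _ _ _));
  [by apply: measurableU; exact: measurableI|exact: measurableI|].
have le2 := measureU2 P (measurableI _ _ mW mC) (measurableI _ _ mL mC).
apply: (le_trans (leeD le2 (lexx _))) => {le2}.
have IHw := IH _ _ k.+1 (s + 1) FW.
have IHl := IH _ _ k.+1 (s - 1) FL.
have IHs := IH _ _ k s FS.
apply: (le_trans (leeD (leeD (IHw _) (IHl _)) (IHs _))).
- by move=> w [/Aks[<- <-] /andP[i h]]; rewrite roundsS gainS i h addn1.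
- by move=> w [/Aks[<- <-] /andP[i /negbTE h]]; rewrite roundsS gainS i h addn1.
- by move=> w [/Aks[<- <-] /negbTE i]; rewrite roundsS gainS i addn0 addr0.
have PA : P A = (P (A `&` wins t) + P (A `&` losses t) + P (A `&` skips t))%E.
  rewrite -measureU//; last first.
    by apply/seteqP; split => // w [[_ /andP[_ h]] [_ /andP[_]]]; rewrite h.
  rewrite -measureU//; last 2 first.
  - exact: measurableU.
  - by apply/seteqP; split => // w [[|] [_ /andP[i h]] [_]]; rewrite /skips/= i.
  congr (P _); rewrite -!setIUr; apply/seteqP; split => [w Aw|w []//].
  by split => //; rewrite /wins /losses /skips/=; case: (inc t w); case: (hd t w);
      [left; left|left; right|right|right].
have wl := F_unfavourable FA.
rewrite PA.
have fn B : measurable B -> P B \is a fin_num by move=> mB; exact: fin_num_measure.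
rewrite -(fineK (fn _ mW)) -(fineK (fn _ mL)) in wl *.
rewrite lee_fin in wl.
rewrite -(fineK (fn _ mS)) -?EFinD -!EFinM -?EFinD lee_fin.
have a0 : 0 <= fine (P (A `&` wins t)) by exact: fine_ge0.
have b0 : 0 <= fine (P (A `&` losses t)) by exact: fine_ge0.
move: (fine (P (A `&` wins t))) (fine (P (A `&` losses t))) wl a0 b0 => a b ab a0 b0.
have -> : lam * (s + 1) - lam ^+ 2 / 2 * k.+1%:R - L = c + (lam - lam ^+ 2 / 2).
  by rewrite /c -natr1; ring.
have -> : lam * (s - 1) - lam ^+ 2 / 2 * k.+1%:R - L = c + (- lam - lam ^+ 2 / 2).
  by rewrite /c -natr1; ring.
rewrite -/c ![expR (c + _)]expRD -![expR c * _ * _]mulrA -!mulrDr.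
rewrite ler_pM2l ?expR_gt0// lerD2r.
have ch := expR_cosh_le lam0.
have e12 : expR (- lam) <= expR lam by rewrite ler_expR; lra.
rewrite ![expR (_ - _)]expRD mulrAC [X in _ + X <= _]mulrAC -mulrDl.
rewrite [X in _ * X <= _]expRN ler_pdivrMr ?expR_gt0//.
move: (expR lam) (expR (- lam)) (expR (lam ^+ 2 / 2)) ch e12 => x y z xyz yx.
(* Chebyshev's sum inequality: as [a <= b] and [y <= x], [a * x + b * y] is at most half of
   [(a + b) * (x + y)]; the bound on [x + y] finishes. *)
have : 0 <= (x - y) * (b - a) by apply: mulr_ge0; rewrite subr_ge0.
have : 0 <= (2 * z - (x + y)) * (a + b).
  by apply: mulr_ge0; [rewrite subr_ge0|exact: addr_ge0].
lra.
Qed.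

Lemma ville_crossing_le lam L n : 0 <= lam ->
  (P (crossing lam L n 0) <= (expR (- L))%:E)%E.
Proof.
move=> lam0; have -> : - L = lam * 0 - lam ^+ 2 / 2 * 0%:R - L :> R.
  by rewrite !mulr0 subr0 sub0r.
rewrite -[X in P X]setTI -[leRHS]mule1 -(probability_setT P).
by apply: crossing_le => // w _; rewrite /rounds /gain !big_ord0.
Qed.

(** Up to time [n] there are at most [n] rounds, so crossing [u] forces one of the finitely many
    lines for that horizon to be crossed, and the union bound applies. Continuity from below removes
    the horizon. *)
Lemma gain_boundary_le (u : nat -> R) (alpha : R) : lines_below u alpha ->
  (P [set w | exists t, (0 < rounds t w)%N /\ (u (rounds t w) < gain t w)%R] <=
    alpha%:E)%E.
Proof.
move=> lines.
pose E n := \bigcup_(t in [set t | (t <= n)%N])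
  [set w | (0 < rounds t w)%N /\ u (rounds t w) < gain t w].
have mE n : measurable (E n).
  apply: bigcup_measurable => t _.
  exact: (measurable_rounds_gain (fun k s => (0 < k)%N /\ u k < s)).
have EU : [set w | exists t, (0 < rounds t w)%N /\ u (rounds t w) < gain t w] =
    \bigcup_n E n.
  apply/seteqP; split => w /=; first by move=> [t ?]; exists t => //; exists t => /=.
  by move=> [n _ [t _ ?]]; exists t.
have ndE : nondecreasing_seq E.
  move=> m n mn; apply/subsetPset => w [t tm ?]; exists t => //.
  exact: leq_trans mn.
rewrite EU.
have cE : P (E n) @[n --> \oo] --> P (\bigcup_n E n).
  by apply: nondecreasing_cvg_mu => //; exact: bigcupT_measurable.
rewrite -(cvg_lim _ cE)//; apply: lime_le; first by apply/cvg_ex; eexists; exact: cE.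
apply: nearW => n; have [J [lam [L [lam0 sumL cross]]]] := lines n.
have rounds_le t w : (rounds t w <= t)%N.
  by rewrite -[leqRHS]card_ord -sum1_card leq_sum// => i _; case: (inc i w).
apply: (@le_trans _ _ (\sum_(j < J) P (crossing (lam j) (L j) n.+1 0))%E).
  apply: (@content_subadditive _ _ _ P _ (fun j => crossing (lam j) (L j) n.+1 0)).
  - by move=> j _; exact: measurable_crossing.
  - exact: mE.
  move=> w [t tn [k0 us]].
  rewrite -(bigcup_mkord J (fun j => crossing (lam j) (L j) n.+1 0)).
  have [] := cross _ (gain t w) _ _ us; last by move=> j jJ ?; exists j => //; exists t.
    by rewrite k0 (leq_trans (rounds_le _ _)).
  exact: gain_le_rounds.
apply: (@le_trans _ _ (\sum_(j < J) (expR (- L j))%:E)%E).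
  by apply: lee_sum => j _; exact: ville_crossing_le.
by rewrite sumEFin lee_fin.
Qed.

End gambling.

(** * Mirror-conservative p-values *)

Section masked_bit.
Variable R : realType.
Implicit Types B : set R.

Lemma measurable_gmask : measurable_fun [set: R] (@gmask R).
Proof.
by apply: measurable_minr => //; exact: measurable_funB.
Qed.

Lemma gmask_lt_half (r : R) : r < 2^-1 -> gmask r = r.
Proof. by move=> r2; rewrite /gmask min_l//; lra. Qed.

Lemma gmask_ge_half (r : R) : 2^-1 <= r -> gmask r = 1 - r.
Proof. by move=> r2; rewrite /gmask min_r//; lra. Qed.

Variables (d : measure_display) (T : measurableType d) (P : probability T R).
Variables (X : T -> R) (mX : measurable_fun setT X)
  (X01 : forall w, 0 <= X w <= 1) (mcX : mirror_conservative P X).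

Let mpre B : measurable B -> measurable (X @^-1` B).
Proof. by move=> mB; rewrite -[X in measurable X]setTI; exact: mX. Qed.

Let reflect (r : R) := 1 - r.

Let reflectK r : reflect (reflect r) = r.
Proof. by rewrite /reflect opprB addrC subrK. Qed.

Let measurable_reflect : measurable_fun [set: R] reflect.
Proof. exact: measurable_funB. Qed.

Let mrpre B : measurable B -> measurable (reflect @^-1` B).
Proof. by move=> mB; rewrite -[X in measurable X]setTI; exact: measurable_reflect. Qed.

Lemma lebesgue_measure_reflect B : measurable B ->
  pushforward lebesgue_measure (reflect : R -> measurableTypeR R) B =
  lebesgue_measure B.
Proof.
move=> mB; apply/esym/lebesgue_measure_unique => //= _ [[a b]] _ <-.
rewrite /pushforward (_ : _ @^-1` _ = `[1 - b, 1 - a[%classic).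
  rewrite !lebesgue_measure_itv/= !lte_fin ltrD2l ltrN2.
  by case: ifPn => // _; rewrite -!EFinB; congr (_%:E); ring.
by apply/seteqP; split => r /=; rewrite !in_itv/= /reflect => /andP[? ?];
  apply/andP; split; lra.
Qed.

(** The inequality between atoms is summed over [B] intersected with [S], outside which [X] has no
    mass. *)
Let countable_case (S : set R) B : countable S -> P (X @^-1` S) = 1%E ->
  (forall a : R, 0 <= a <= 2^-1 ->
       (P (X @^-1` [set a]) <= P (X @^-1` [set (1 - a)%R]))%E) ->
  measurable B -> B `<=` [set r | 0 <= r < 2^-1] ->
  (P (X @^-1` B) <= P (X @^-1` (reflect @^-1` B)))%E.
Proof.
move=> cS PS fS mB B2.
have mS : measurable S by exact: countable_measurable.
have cBS : countable (B `&` S).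
  exact: sub_countable (subset_card_le (@subIsetr _ _ _)) cS.
have mBS : measurable (B `&` S) by exact: measurableI.
have SC : P (X @^-1` ~` S) = 0%E.
  by rewrite preimage_setC probability_setC ?PS ?subee//; exact: mpre.
apply: (@le_trans _ _ (P (X @^-1` (B `&` S)))).
  rewrite (_ : X @^-1` B = X @^-1` (B `&` S) `|` X @^-1` (B `&` ~` S)); last first.
    by rewrite -preimage_setU -setIUr setUv setIT.
  have mBC : measurable (B `&` ~` S) by apply: measurableI => //; exact: measurableC.
  apply: le_trans (measureU2 _ _ _) _; [exact: mpre|exact: mpre|].
  rewrite geeDl// -SC; apply: le_measure; rewrite ?inE.
  - exact: mpre.
  - by apply: mpre; exact: measurableC.
  - by move=> w [].
apply: (@le_trans _ _ (P (X @^-1` (reflect @^-1` (B `&` S))))); last first.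
  apply: le_measure; rewrite ?inE; last by move=> w [].
    exact: mpre (mrpre mBS).
  exact: mpre (mrpre mB).
(* The fibres [A n] of the numbering [f] are empty or singletons. *)
have [f finj] := countable_injP _ cBS.
pose A n : set R := [set a | (B `&` S) a /\ f a = n].
have A1 n : A n = set0 \/ exists2 a, (B `&` S) a & A n = [set a].
  have [->|/set0P[a [Ba fa]]] := eqVneq (A n) set0; first by left.
  right; exists a => //; apply/seteqP; split => [b [Bb fb]|b ->] //=.
  by apply: finj; rewrite ?inE// fa fb.
have mA n : measurable (A n) by have [->|[a _ ->]] := A1 n.
have tA (Y : T -> R) : trivIset setT (fun n => Y @^-1` A n).
  by move=> m n _ _ [w [[_ <-] [_ <-]]].
have BSE : B `&` S = \bigcup_n A n.
  by apply/seteqP; split => [a Ba|a [n _ []]//]; exists (f a).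
have sumA (Y : T -> R) : (forall n, measurable (Y @^-1` A n)) ->
    P (Y @^-1` \bigcup_n A n) = (\sum_(n <oo | n \in setT) P (Y @^-1` A n))%E.
  by move=> mY; rewrite preimage_bigcup measure_bigcup.
rewrite BSE (sumA X)//; last by move=> n; exact: mpre.
rewrite (sumA (reflect \o X)); last by move=> n; exact: (mpre (mrpre (mA n))).
apply: lee_nneseries => // n _.
have [->|[a [Ba _] ->]] := A1 n; first by rewrite !preimage_set0 !measure0.
have := fS a; have /andP[a0 /ltW a2] := B2 _ Ba; rewrite a0 a2 => /(_ isT) aa.
apply: (le_trans aa); rewrite [X in (_ <= X)%E](_ : _ = P (X @^-1` [set 1 - a]))//.
congr (P _); apply/seteqP; split => w /=; first by move=> <-; exact: esym (reflectK _).
by move=> ->; exact: reflectK.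
Qed.

(** Lebesgue measure is invariant under the reflection, so a change of variables makes the
    right-hand side the integral of [f (1 - a)] over [B], where the densities compare pointwise. *)
Let density_case (f : R -> R) B : (forall a, 0 <= f a) -> measurable_fun setT f ->
  (forall A : set R, measurable A ->
        P (X @^-1` A) = (\int[lebesgue_measure]_(a in A) (f a)%:E)%E) ->
  (forall a : R, 0 <= a <= 2^-1 -> f a <= f (1 - a)) ->
  measurable B -> B `<=` [set r | 0 <= r < 2^-1] ->
  (P (X @^-1` B) <= P (X @^-1` (reflect @^-1` B)))%E.
Proof.
move=> f0 mf Pf fS mB B2.
have mE : measurable_fun setT (EFin \o f) by exact/measurable_EFinP.
rewrite !Pf//; last exact: mrpre.
have -> : (\int[lebesgue_measure]_(a in reflect @^-1` B) (f a)%:E =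
    \int[pushforward lebesgue_measure (reflect : R -> measurableTypeR R)]_(a in
      reflect @^-1` B) (f a)%:E)%E.
  by apply: eq_measure_integral => A mA _; exact/esym/lebesgue_measure_reflect.
rewrite ge0_integral_pushforward//; last 3 first.
- exact: mrpre.
- exact: measurable_funTS.
- by move=> a _; rewrite lee_fin.
rewrite (_ : reflect @^-1` (reflect @^-1` B) = B); last first.
  by apply/seteqP; split => r; rewrite /preimage/= reflectK.
apply: ge0_le_integral => //.
- by move=> a _; rewrite lee_fin.
- exact: measurable_funTS.
- by apply: measurable_funTS; exact: measurableT_comp.
move=> a /B2 /andP[a0 a2] /=; rewrite lee_fin fS// a0 ltW//.
Qed.

Lemma mirror_conservative_reflect B : measurable B ->
  B `<=` [set r | 0 <= r < 2^-1] ->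
  (P (X @^-1` B) <= P (X @^-1` (reflect @^-1` B)))%E.
Proof.
case: mcX => [[S [cS [PS fS]]]|[f [f0 [mf [Pf fS]]]]].
  exact: countable_case cS PS fS.
exact: density_case f0 mf Pf fS.
Qed.

(** Below 1/2 the mask is the identity, so the left event is [X] lying in [B] cut to [[0, 1/2[]. The
    reflection preserves the mask and carries this set into the right one, which may also contain
    1/2. *)
Lemma masked_bit_unfavourable B : measurable B ->
  (P (X @^-1` (@gmask R @^-1` B `&` [set r | (r < 2^-1)%R])) <=
   P (X @^-1` (@gmask R @^-1` B `&` [set r | (2^-1 <= r)%R])))%E.
Proof.
move=> mB.
have m01 : measurable [set r : R | 0 <= r < 2^-1] by exact: (measurable_itv `[0, 2^-1[).
have mB1 : measurable (B `&` [set r : R | 0 <= r < 2^-1]) by exact: measurableI.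
rewrite (_ : X @^-1` _ = X @^-1` (B `&` [set r : R | 0 <= r < 2^-1])); last first.
  apply/seteqP; split => w [/= Bw]; last by move=> /andP[_ r2]; rewrite gmask_lt_half.
  move=> r2; rewrite gmask_lt_half// in Bw; split => //=.
  by rewrite r2 andbT; have /andP[] := X01 w.
apply: le_trans (mirror_conservative_reflect mB1 _) _; first by move=> r [].
apply: le_measure; rewrite ?inE.
- by apply: mpre; exact: mrpre.
- apply: mpre; apply: measurableI.
    by rewrite -[X in measurable X]setTI; exact: measurable_gmask.
  rewrite (_ : mkset _ = `[2^-1, +oo[%classic) //.
  by apply/seteqP; split => r /=; rewrite in_itv/= andbT.
move=> w [/= Br /andP[r0 r2]].
have w2 : 2^-1 <= X w by move: r2; rewrite /reflect; lra.
by split => //=; rewrite gmask_ge_half.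
Qed.

End masked_bit.

(** * Independence *)

Section independent_pair.
Context d d1 d2 (T : measurableType d) (T1 : measurableType d1)
  (T2 : measurableType d2) (R : realType) (P : probability T R).
Variables (X : T -> T1) (Y : T -> T2).
Hypotheses (mX : measurable_fun setT X) (mY : measurable_fun setT Y).
Hypothesis indepXY : forall B C, measurable B -> measurable C ->
  P (X @^-1` B `&` Y @^-1` C) = (P (X @^-1` B) * P (Y @^-1` C))%E.

Let fX : {mfun T >-> T1} := HB.pack X (isMeasurableFun.Build _ _ _ _ _ mX).
Let fY : {mfun T >-> T2} := HB.pack Y (isMeasurableFun.Build _ _ _ _ _ mY).
Let fXY : {mfun T >-> (T1 * T2)%type} := HB.pack (fun w => (X w, Y w))
  (isMeasurableFun.Build _ _ _ _ _ (measurable_fun_pair mX mY)).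

(** By independence the joint law and the iterated integral both agree with the product measure on
    rectangles, hence everywhere. *)
Lemma probability_pair E : measurable E ->
  P [set w | E (X w, Y w)] =
  (\int[distribution P fY]_y P (X @^-1` ysection E y))%E.
Proof.
move=> mE.
rewrite -[LHS]/(distribution P fXY E).
rewrite -[RHS]/((distribution P fX \x^ distribution P fY)%E E).
rewrite -(@product_measure_unique _ _ _ _ _ (distribution P fX)
  (distribution P fY) (distribution P fXY))//.
by apply: product_measure_unique => //= A B mA mB; rewrite product_measure2E.
Qed.

Lemma independent_pair_le E1 E2 : measurable E1 -> measurable E2 ->
  (forall y, (P (X @^-1` ysection E1 y) <= P (X @^-1` ysection E2 y))%E) ->
  (P [set w | E1 (X w, Y w)] <= P [set w | E2 (X w, Y w)])%E.
Proof.
move=> mE1 mE2 le12; rewrite !probability_pair//.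
apply: ge0_le_integral => //.
- exact: (measurable_fun_ysection (distribution P fX)).
- exact: (measurable_fun_ysection (distribution P fX)).
Qed.

End independent_pair.

(** * Events that leave one p-value masked *)

Section masked_information.
Context (R : realType) (d : measure_display) (T : measurableType d)
  (P : probability T R) (dX : measure_display) (X : measurableType dX)
  (I : eqType) (x : I -> T -> X) (p : I -> T -> R).
Hypotheses (mx : forall i, measurable_fun setT (x i))
  (mp : forall i, measurable_fun setT (p i))
  (p01 : forall i w, 0 <= p i w <= 1)
  (mcp : forall i, mirror_conservative P (p i)).

Let info (o : option I) :=
  match o with None => sigma_family x | Some i => sigmaR (p i) end.

Hypothesis indep : mutually_independent P info.

(* Everything but [p i]: the covariate of [i] is included. *)
Definition others (i : I) : set (set T) :=
  [set A | (exists j (B : set X), measurable B /\ A = x j @^-1` B) \/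
           (exists j (B : set R), j != i /\ measurable B /\ A = p j @^-1` B)].

Definition masked (i : I) : set (set T) :=
  others i `|` [set A | exists B : set R, measurable B /\
                          A = (fun w => gmask (p i w)) @^-1` B].

Let mpre i B : measurable B -> measurable (p i @^-1` B).
Proof. by move=> mB; rewrite -[X in measurable X]setTI; exact: mp. Qed.

Let others_measurable i : <<s others i>> `<=` measurable.
Proof.
apply: smallest_sub; first exact: sigma_algebra_measurable.
move=> _ [[j [B [mB ->]]]|[j [B [_ [mB ->]]]]]; last exact: mpre.
by rewrite -[X in measurable X]setTI; exact: mx.
Qed.

Let info_measurable o : info o `<=` measurable.
Proof.
case: o => [i|] /=; first by move=> _ [B [mB ->]]; exact: mpre.
apply: smallest_sub; first exact: sigma_algebra_measurable.
by move=> _ [j [B [mB ->]]]; rewrite -[X in measurable X]setTI; exact: mx.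
Qed.

Let infoT o : info o setT.
Proof.
case: o => [i|] /=; first by exists setT; split; rewrite ?preimage_setT.
exact: (@measurableT _ (g_sigma_algebraType _)).
Qed.

Let infoI o : setI_closed (info o).
Proof.
case: o => [i|] A B /=; last exact: (@measurableI _ (g_sigma_algebraType _)).
by move=> [A' [mA ->]] [B' [mB ->]]; exists (A' `&` B'); split => //; exact: measurableI.
Qed.

(** A pi-system whose generated sigma-algebra contains [others i] and on which independence from
    [p i] is directly the hypothesis [indep]. *)
Let cylinders i : set (set T) := [set C | exists J (A : option I -> set T),
  [/\ uniq J, Some i \notin J, (forall o, o \in J -> info o (A o)) &
      C = \bigcap_(o in [set` J]) A o]].

Let cylinders_measurable i : cylinders i `<=` measurable.
Proof.
move=> _ [J [A [_ _ iA ->]]]; apply: fin_bigcap_measurable => [|o /= oJ].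
  exact: finite_seq.
exact: info_measurable (iA _ oJ).
Qed.

Let cylindersI i : setI_closed (cylinders i).
Proof.
move=> _ _ [J1 [A1 [u1 i1 iA1 ->]]] [J2 [A2 [u2 i2 iA2 ->]]].
exists (undup (J1 ++ J2)), (fun o => (if o \in J1 then A1 o else setT) `&`
  (if o \in J2 then A2 o else setT)); split.
- exact: undup_uniq.
- by rewrite mem_undup mem_cat negb_or i1.
- move=> o _; apply: infoI; case: ifPn => oJ; rewrite ?infoT//; [exact: iA1|exact: iA2].
apply/seteqP; split => [w [w1 w2] o /= _|w wJ].
  by split; case: ifPn => // oJ; [exact: w1|exact: w2].
split => o /= oJ; have := wJ o; rewrite /= mem_undup mem_cat oJ ?orbT => /(_ isT) [].
  by [].
by [].
Qed.

(** As functions of [C] both sides are finite measures; they agree on the pi-system [cylinders i],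
    hence on the sigma-algebra it generates. *)
Lemma independent_others i B C : measurable B -> <<s others i>> C ->
  P (p i @^-1` B `&` C) = (P (p i @^-1` B) * P C)%E.
Proof.
move=> mB sC.
have mpB := mpre i mB.
have r0 : 0 <= fine (P (p i @^-1` B)) by exact: fine_ge0.
pose r := NngNum r0.
have rE : (r%:num)%:E = P (p i @^-1` B) by rewrite fineK//; exact: fin_num_measure.
suff : mrestr P mpB C = mscale r P C.
  by rewrite /mrestr /mscale setIC rE.
apply: (g_sigma_algebra_measure_unique (cylinders i) _ (fun=> setT)) => //.
- by move=> _; exists [::], (fun=> setT); split => //; apply/seteqP; split.
- by rewrite bigcup_const//; exists 0%N.
- move=> _ [J [A [uJ iJ iA ->]]]; 
  suff : P (\bigcap_(o in [set` J]) A o `&` p i @^-1` B) =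
      (r%:num%:E * P (\bigcap_(o in [set` J]) A o))%E by [].
  rewrite rE (indep uJ iA).
  pose A' o := if o == Some i then p i @^-1` B else A o.
  have A'E o : o \in J -> A' o = A o.
    by move=> oJ; rewrite /A'; case: eqP => // oi; rewrite -oi oJ in iJ.
  have -> : \bigcap_(o in [set` J]) A o `&` p i @^-1` B =
      \bigcap_(o in [set` Some i :: J]) A' o.
    apply/seteqP; split => [w [wJ wi] o /=|w wJ].
      by rewrite inE => /predU1P[->|oJ]; [rewrite /A' eqxx|rewrite A'E//; exact: wJ].
    split=> [q /= oJ|]; first by rewrite -A'E//; apply: wJ; rewrite /= inE oJ orbT.
    by have := wJ (Some i); rewrite /= inE eqxx /A' eqxx; exact.
  rewrite indep/=; last 2 first.
  - by rewrite iJ.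
  - move=> o; rewrite inE => /predU1P[->|oJ]; last by rewrite A'E//; exact: iA.
    by rewrite /A' eqxx; exists B.
  rewrite big_cons {1}/A' eqxx; congr (_ * _)%E.
  by apply: eq_big_seq => o oJ; rewrite A'E.
- by move=> _; rewrite /mrestr ltey_eq fin_num_measure//; exact: measurableI.
- apply: sub_sigma_algebra2 sC => _ [[j [D [mD ->]]]|[j [D [ji [mD ->]]]]].
  + exists [:: None], (fun=> x j @^-1` D); split => //.
      by move=> o; rewrite inE => /eqP ->; apply: sub_sigma_algebra; exists j, D.
    by apply/seteqP; split => [w wD o _//|w]; apply; rewrite /= inE.
  + exists [:: Some j], (fun=> p j @^-1` D); split => //.
    * by rewrite inE; apply: contra ji => /eqP[->].
    * by move=> o; rewrite inE => /eqP ->; exists D.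
    by apply/seteqP; split => [w wD o _//|w]; apply; rewrite /= inE.
Qed.

Lemma masked_measurable i : <<s masked i>> `<=` measurable.
Proof.
apply: smallest_sub; first exact: sigma_algebra_measurable.
move=> A [oA|[B [mB ->]]]; first by apply: (@others_measurable i); exact: sub_sigma_algebra.
apply: (mpre i (B := @gmask R @^-1` B)).
by rewrite -[X in measurable X]setTI; exact: measurable_gmask.
Qed.

(** [A] is determined by the mask of [p i] and the remaining data, which are independent of [p i].
    With these data fixed, the claim is [masked_bit_unfavourable], and integration over their law
    preserves it. *)
Lemma masked_unfavourable i A : <<s masked i>> A ->
  (P (A `&` [set w | (p i w < 2^-1)%R]) <= P (A `&` [set w | (2^-1 <= p i w)%R]))%E.
Proof.
move=> sA.
pose T' : measurableType _ := g_sigma_algebraType (others i).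
(* The identity into [T] with the coarser sigma-algebra turns all remaining data into one random
   element. *)
pose Y : T -> T' := id.
have mY : measurable_fun setT Y.
  move=> _ C sC; rewrite setTI; exact: (others_measurable sC).
pose Z w : R * T' := (gmask (p i w), Y w).
have [E mE AE] : exists2 E : set (R * T')%type, measurable E & A = Z @^-1` E.
  suff : preimage_set_system setT Z measurable A.
    by move=> [E mE <-]; exists E => //; rewrite setTI.
  apply: smallest_sub sA.
    by apply: sigma_algebra_preimage; exact: sigma_algebra_measurable.
  move=> D [oD|[B [mB ->]]].
    exists (setT `*` D); last by rewrite setTI; apply/seteqP; split => w //= [].
    apply: measurableX => //; exact: sub_sigma_algebra.
  exists (B `*` setT); last by rewrite setTI; apply/seteqP; split => w //= [].
  exact: measurableX.
pose H (D : set R) : set (R * T')%type := [set z | E (gmask z.1, z.2) /\ D z.1].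
have mH D : measurable D -> measurable (H D).
  move=> mD; rewrite (_ : H D = (fun z => (gmask z.1, z.2)) @^-1` E `&` (D `*` setT)).
    apply: measurableI; last exact: measurableX.
    rewrite -[X in measurable X]setTI.
    suff : measurable_fun [set: R * T'] (fun z : R * T' => (gmask z.1, z.2)) by exact.
    apply: measurable_fun_pair; last exact: measurable_snd.
    exact: measurableT_comp (@measurable_gmask R) measurable_fst.
  by apply/seteqP; split => [z []//|z [? []]//].
have AH (D : set R) : A `&` [set w | D (p i w)] = [set w | H D (p i w, Y w)].
  by rewrite AE; apply/seteqP; split => w [].
have mlt : measurable [set r : R | r < 2^-1] by exact: (measurable_itv `]-oo, 2^-1[).
have mge : measurable [set r : R | 2^-1 <= r].
  have -> : [set r : R | 2^-1 <= r] = ~` [set r : R | r < 2^-1].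
    by apply/seteqP; split => r /=; rewrite leNgt => /negP.
  exact: measurableC.
rewrite (AH [set r | r < 2^-1]) (AH [set r | 2^-1 <= r]).
apply: independent_pair_le => //; [|exact: mH|exact: mH|].
  by move=> B C mB mC; apply: independent_others.
move=> y.
have mEy : measurable (ysection E y) by exact: measurable_ysection.
have yH (D : set R) : ysection (H D) y = @gmask R @^-1` ysection E y `&` D.
  by apply/seteqP; split => r; rewrite /ysection /H/= !inE.
by rewrite !yH; exact: masked_bit_unfavourable.
Qed.

End masked_information.

(** * The two versions of the test *)

Section Online.
Context (R : realType) (d : measure_display) (T : measurableType d)
  (P : probability T R) (dX : measure_display) (X : measurableType dX)
  (x : nat -> T -> X) (p : nat -> T -> R) (incl : nat -> T -> bool).
Hypotheses (mx : forall i, measurable_fun setT (x i))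
  (mp : forall i, measurable_fun setT (p i))
  (p01 : forall i w, 0 <= p i w <= 1)
  (mcp : forall i, mirror_conservative P (p i)).
Hypothesis indep : mutually_independent P
  (fun o : option nat => match o with
                         | None => sigma_family x
                         | Some i => sigmaR (p i) end).
Hypothesis mincl : forall t, Fonline x p t [set w | incl t w].

Let FonlineI t : setI_closed (Fonline x p t).
Proof. exact: (@measurableI _ (g_sigma_algebraType _)). Qed.

Let FonlineC t A : Fonline x p t A -> Fonline x p t (~` A).
Proof. exact: (@measurableC _ (g_sigma_algebraType _)). Qed.

Let Fonline_measurable t : Fonline x p t `<=` measurable.
Proof.
apply: smallest_sub; first exact: sigma_algebra_measurable.
move=> _ [[i [B [_ [mB ->]]]]|[[i [B [_ [mB ->]]]]|[i [B [_ [mB ->]]]]]];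
  rewrite -[X in measurable X]setTI; [exact: mx| |exact: mp].
have : measurable_fun setT (fun w => gmask (p i w)).
  exact: measurableT_comp (@measurable_gmask R) (mp i).
exact.
Qed.

Let FonlineS t : Fonline x p t `<=` Fonline x p t.+1.
Proof.
apply: sub_sigma_algebra2.
move=> _ [[i [B [it [mB ->]]]]|[[i [B [it [mB ->]]]]|[i [B [it [mB ->]]]]]].
- by left; exists i, B; rewrite leqW.
- by right; left; exists i, B; rewrite leqW.
- by right; right; exists i, B; rewrite leqW.
Qed.

Let Fonline_bit t (D : set R) : measurable D ->
  Fonline x p t.+1 (p t @^-1` D).
Proof. by move=> mD; apply: sub_sigma_algebra; right; right; exists t, D. Qed.

(** Before the decision on [t] only the mask of [p t] is visible; any other mask is a function of a
    p-value in [others t]. *)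
Let Fonline_masked t : Fonline x p t `<=` <<s masked x p t>>.
Proof.
apply: smallest_sub; first exact: smallest_sigma_algebra.
move=> _ [[i [B [it [mB ->]]]]|[[i [B [it [mB ->]]]]|[i [B [it [mB ->]]]]]];
  apply: sub_sigma_algebra.
- by left; left; exists i, B.
- have [->|ti] := eqVneq i t; first by right; exists B.
  left; right; exists i, (@gmask R @^-1` B); split => //; split => //.
  by rewrite -[X in measurable X]setTI; exact: measurable_gmask.
- by left; right; exists i, B; rewrite ltn_eqF.
Qed.

Lemma online_type1 (u : nat -> R) (alpha : R) : lines_below u alpha ->
  (P [set w | exists t, (0 < Konline incl t w)%N /\
                        (Sonline p incl t w > u (Konline incl t w))%R]
    <= alpha%:E)%E.
Proof.
move=> lines; pose hd t w := p t w < 2^-1.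
(* [Konline] and [Sonline] at [t] are [rounds] and [gain] at [t.+1]; time 0 adds nothing, as
   [rounds] vanishes there. *)
have -> : [set w | exists t, (0 < Konline incl t w)%N /\
                        (Sonline p incl t w > u (Konline incl t w))%R] =
    [set w | exists t, (0 < rounds incl t w)%N /\
                       u (rounds incl t w) < gain R incl hd t w].
  apply/seteqP; split => w [t H]; first by exists t.+1.
  by case: t H => [|t]; [rewrite /rounds big_ord0; case|exists t].
have mlt : measurable [set r : R | r < 2^-1] by exact: (measurable_itv `]-oo, 2^-1[).
have winE t : wins incl hd t =
    [set w | incl t w] `&` p t @^-1` [set r | r < 2^-1].
  by apply/seteqP; split => w /= /andP.
have lossE t : losses incl hd t =
    [set w | incl t w] `&` p t @^-1` (~` [set r | r < 2^-1]).
  by apply/seteqP; split => w; rewrite /losses/=;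
    [move=> /andP[-> /negP]|move=> [-> /negP]].
apply: (gain_boundary_le (F := Fonline x p)) => //.
- by move=> t; exact: (@measurableT _ (g_sigma_algebraType _)).
- move=> t A FA; rewrite winE setIA; apply: FonlineI; last exact: Fonline_bit.
  by apply: FonlineS; apply: FonlineI.
- move=> t A FA; rewrite lossE setIA; apply: FonlineI.
    by apply: FonlineS; apply: FonlineI.
  by apply: Fonline_bit; exact: measurableC.
- move=> t A FA; apply: FonlineS; apply: FonlineI => //.
  rewrite (_ : skips incl t = ~` [set w | incl t w]); first exact: FonlineC.
  by apply/seteqP; split => w /= /negP.
- move=> t A FA; rewrite winE lossE !setIA.
  have /Fonline_masked FAm : Fonline x p t (A `&` [set w | incl t w]) by exact: FonlineI.
  have := masked_unfavourable mx mp p01 mcp indep FAm.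
  rewrite (_ : [set w | _ <= p t w] = p t @^-1` (~` [set r | r < 2^-1])) //.
  by apply/seteqP; split => w /=; rewrite leNgt => /negP.
Qed.

End Online.

(** * Batch version: the order of the hypotheses depends on the data *)

Section Batch.
Context (R : realType) (d : measure_display) (T : measurableType d)
  (P : probability T R) (dX : measure_display) (X : measurableType dX) (n : nat)
  (x : 'I_n -> T -> X) (p : 'I_n -> T -> R) (istar : nat -> T -> 'I_n).
Hypotheses (mx : forall i, measurable_fun setT (x i))
  (mp : forall i, measurable_fun setT (p i))
  (p01 : forall i w, 0 <= p i w <= 1)
  (mcp : forall i, mirror_conservative P (p i)).
Hypothesis indep : mutually_independent P
  (fun o : option 'I_n => match o with
                          | None => sigma_family x
                          | Some i => sigmaR (p i) end).
Hypothesis istar_new : forall k w, (1 <= k <= n)%N ->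
  ~~ inM istar k.-1 w (istar k w).
Hypothesis mistar : forall k (j : 'I_n), (1 <= k <= n)%N ->
  Fbatch x p istar k.-1 [set w | istar k w = j].

Let unselected t i := [set w | ~~ inM istar t w i].

Let inMS t w i : inM istar t.+1 w i = inM istar t w i || (istar t.+1 w == i).
Proof.
apply/existsP/orP => [[j jE]|[/existsP[j jE]|iE]].
- have [jt|jt] := ltnP j t; first by left; apply/existsP; exists (Ordinal jt).
  right; rewrite -(eqP jE) (_ : nat_of_ord j = t)//.
  by apply/eqP; rewrite eqn_leq jt -ltnS ltn_ord.
- by exists (widen_ord (leqnSn t) j).
- by exists ord_max.
Qed.

Let maskedI i : setI_closed <<s masked x p i>>.
Proof. exact: (@measurableI _ (g_sigma_algebraType _)). Qed.

Let maskedU i : setU_closed <<s masked x p i>>.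
Proof. exact: (@measurableU _ (g_sigma_algebraType _)). Qed.

Let maskedD i : setD_closed <<s masked x p i>>.
Proof. exact: (@measurableD _ (g_sigma_algebraType _)). Qed.

Let masked_bigcup i (D : set 'I_n) (F : 'I_n -> set T) :
  (forall j, D j -> <<s masked x p i>> (F j)) ->
  <<s masked x p i>> (\bigcup_(j in D) F j).
Proof.
by apply: (@fin_bigcup_measurable _ (g_sigma_algebraType (masked x p i)) _ D F).
Qed.

Let masked_bit j i D : j != i -> measurable D -> <<s masked x p i>> (p j @^-1` D).
Proof. by move=> ji mD; apply: sub_sigma_algebra; left; right; exists j, D. Qed.

(* As long as [i] is unselected, the information of the analyst about it is
   limited to its masked value. *)
Let Fbatch_unselected i t :
  (forall j, <<s masked x p i>> ([set w | inM istar t w j] `&` unselected t i)) ->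
  <<s masked x p i>> (unselected t i) ->
  forall A, Fbatch x p istar t A -> <<s masked x p i>> (A `&` unselected t i).
Proof.
move=> sel unsel.
apply: smallest_sub.
  split => [|A sA|A sA].
  - by rewrite set0I; exact: (@measurable0 _ (g_sigma_algebraType _)).
  - rewrite (_ : _ `&` _ = unselected t i `\` (A `&` unselected t i)); first exact: maskedD.
    apply/seteqP; split => w [].
      by move=> [_ nA] U; split => // -[].
    by move=> U nAU; split => //; split => // ?; exact: nAU.
  - rewrite setI_bigcupl; exact: (@bigcupT_measurable _ (g_sigma_algebraType _)).
move=> _ [[j [B [mB ->]]]|[[j [B [mB ->]]]|[j [B [mB ->]]]]].
- by apply: maskedI => //; apply: sub_sigma_algebra; left; left; exists j, B.
- apply: maskedI => //; apply: sub_sigma_algebra.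
  have [->|ji] := eqVneq j i; first by right; exists B.
  left; right; exists j, (@gmask R @^-1` B); split => //; split => //.
  by rewrite -[X in measurable X]setTI; exact: measurable_gmask.
- have [->|ji] := eqVneq j i.
    rewrite (_ : _ `&` _ = set0); first exact: (@measurable0 _ (g_sigma_algebraType _)).
    by apply/seteqP; split => // w [[/= iM _]]; rewrite /unselected/= iM.
  rewrite (_ : _ `&` _ = [set w | inM istar t w j] `&` unselected t i `&` p j @^-1` B).
    by apply: maskedI => //; exact: masked_bit.
  by apply/seteqP; split => w /= [[]].
Qed.

(** Both claims go through one induction: where [i] is unselected after [t] steps, the next choice
    depends on masked information only, and staying unselected means that this choice is not [i]. *)
Let selection_masked i t : (t <= n)%N ->
  (forall j, <<s masked x p i>> ([set w | inM istar t w j] `&` unselected t i)) /\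
  <<s masked x p i>> (unselected t i).
Proof.
elim: t => [_|t IH tn].
  have inM0 w j : inM istar 0 w j = false by apply/existsP => -[[]].
  split => [j|].
    rewrite (_ : _ `&` _ = set0); first exact: (@measurable0 _ (g_sigma_algebraType _)).
    by apply/seteqP; split => // w [] /=; rewrite inM0.
  rewrite (_ : unselected 0 i = setT); first exact: (@measurableT _ (g_sigma_algebraType _)).
  by apply/seteqP; split => // w _; rewrite /unselected/= inM0.
have [sel unsel] := IH (ltnW tn).
have step j : <<s masked x p i>> ([set w | istar t.+1 w = j] `&` unselected t i).
  by apply: Fbatch_unselected => //; exact: (mistar j (k := t.+1)).
have unselS : unselected t.+1 i =
    unselected t i `\` ([set w | istar t.+1 w = i] `&` unselected t i).
  apply/seteqP; split => w; rewrite /unselected/= inMS negb_or.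
    by move=> /andP[-> /eqP ?]; split => // -[].
  by move=> [-> ni]; apply/eqP => ii; exact: ni.
have unsel' : <<s masked x p i>> (unselected t.+1 i) by rewrite unselS; exact: maskedD.
split => // j.
rewrite (_ : _ `&` _ = ([set w | inM istar t w j] `&` unselected t i `|`
   [set w | istar t.+1 w = j] `&` unselected t i) `&` unselected t.+1 i).
  by apply: maskedI => //; exact: maskedU.
apply/seteqP; split => w; rewrite /unselected/= !inMS negb_or => -[].
  by move=> /orP[jM|/eqP jM] /andP[iM ii]; split; rewrite ?iM//; [left|right].
by move=> [[-> _]|[-> _]] ->; rewrite ?eqxx ?orbT.
Qed.

(** Choosing [i] now implies that it was unselected before, so [Fbatch_unselected] covers the whole
    event. *)
Let selected_masked t i : (t < n)%N -> <<s masked x p i>> [set w | istar t.+1 w = i].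
Proof.
move=> tn; have [sel unsel] := selection_masked i (ltnW tn).
rewrite (_ : mkset _ = [set w | istar t.+1 w = i] `&` unselected t i).
  by apply: Fbatch_unselected => //; exact: (mistar i (k := t.+1)).
apply/seteqP; split => w /= [] // wi; split => //.
by rewrite /unselected/= -wi; exact: (istar_new w (k := t.+1)).
Qed.

(* These classes serve as the filtration instead of [Fbatch t]: monotonicity of
   [Fbatch] would have to be proved.  The game has [n] rounds, hence [minn]. *)
Let past t : set (set T) := [set A | measurable A /\
  forall i, <<s masked x p i>> (A `&` unselected (minn t n) i)].

Let bit_event t (D : set R) := [set w | D (p (istar t.+1 w) w)].

Let past_selected t i A : (t < n)%N -> past t A ->
  <<s masked x p i>> (A `&` [set w | istar t.+1 w = i]).
Proof.
move=> tn [mA /(_ i)]; rewrite (minn_idPl (ltnW tn)) => Ai.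
rewrite (_ : _ `&` _ = (A `&` unselected t i) `&` [set w | istar t.+1 w = i]).
  by apply: maskedI => //; exact: selected_masked.
apply/seteqP; split => w /= [].
  move=> Aw wi; split => //; split => //.
  by rewrite /unselected/= -wi; exact: (istar_new w (k := t.+1)).
by move=> [].
Qed.

Let bit_eventE t A D : A `&` bit_event t D =
  \bigcup_(j in [set: 'I_n]) (A `&` [set w | istar t.+1 w = j] `&` p j @^-1` D).
Proof.
apply/seteqP; split => w.
  by move=> [Aw Dw]; exists (istar t.+1 w).
by move=> [j _ [[Aw /= jw]]] Dw; split => //; rewrite /bit_event/= jw.
Qed.

Let measurable_selected_bit t A D j : (t < n)%N -> past t A -> measurable D ->
  measurable (A `&` [set w | istar t.+1 w = j] `&` p j @^-1` D).
Proof.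
move=> tn pA mD; apply: measurableI.
  by apply: (masked_measurable mx mp (i := j)); exact: past_selected.
by rewrite -[X in measurable X]setTI; exact: mp.
Qed.

(** If [i] stays unselected, the bit just revealed belongs to some [j != i], whose p-value is
    unmasked in [masked x p i]. *)
Let past_bit t A D : (t < n)%N -> past t A -> measurable D ->
  past t.+1 (A `&` bit_event t D).
Proof.
move=> tn pA mD; split.
  rewrite bit_eventE; apply: fin_bigcup_measurable => // j _.
  exact: measurable_selected_bit.
move=> i; rewrite (minn_idPl tn).
have [_ /(_ i)] := pA; rewrite (minn_idPl (ltnW tn)) => Ai.
have [sel unsel] := selection_masked i (ltnW tn).
rewrite (_ : _ `&` unselected t.+1 i = \bigcup_(j in [set j | j != i])
   ((A `&` unselected t i) `&` ([set w | istar t.+1 w = j] `&` unselected t i)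
    `&` p j @^-1` D)).
  apply: masked_bigcup => j /= ji.
  apply: maskedI; last exact: masked_bit.
  apply: maskedI => //.
  by apply: Fbatch_unselected => //; exact: (mistar j (k := t.+1)).
apply/seteqP; split => w.
  move=> [[Aw Dw]]; rewrite /unselected/= inMS negb_or => /andP[iM ii].
  by exists (istar t.+1 w).
move=> [j /= ji [[[Aw iM] [jw _]] Dw]]; split; first by split => //; rewrite /bit_event/= jw.
by move: iM; rewrite /unselected/= inMS negb_or => ->; rewrite jw.
Qed.

Let probability_bit t A D : (t < n)%N -> past t A -> measurable D ->
  P (A `&` bit_event t D) =
  (\sum_(j \in [set: 'I_n]) P (A `&` [set w | istar t.+1 w = j] `&` p j @^-1` D))%E.
Proof.
move=> tn pA mD; rewrite bit_eventE measure_fin_bigcup//.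
- exact: finite_finset.
- by move=> j k _ _ [w [[[_ <-] _] [[_ <-] _]]].
- by move=> j _; exact: measurable_selected_bit.
Qed.

(** Round [t] of the game is selection step [t.+1]; from time [n] on every round is a skip. *)
Let inc t (w : T) := (t < n)%N.
Let hd t w := p (istar t.+1 w) w < 2^-1.

Let rounds_gain t w : rounds inc t w = minn t n /\
  gain R inc hd t w = Sbatch p istar (minn t n) w.
Proof.
elim: t => [|t [IHr IHg]].
  rewrite min0n /rounds /gain !big_ord0 /Sbatch big_pred0// => i.
  by apply/existsP => -[[]].
rewrite roundsS gainS IHr IHg /inc; have [tn|nt] := ltnP t n; last first.
  by rewrite addn0 addr0 (minn_idPr (leqW nt)).
rewrite (minn_idPl tn) addn1; split => //.
rewrite /Sbatch [RHS](bigD1 (istar t.+1 w))/=; last by rewrite inMS eqxx orbT.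
rewrite addrC; congr (_ + _); apply: eq_bigl => i; rewrite inMS.
have new := @istar_new t.+1 w tn; have [->|ii] := eqVneq i (istar t.+1 w).
  by rewrite andbF (negbTE new).
by rewrite /= orbF andbT.
Qed.

Lemma batch_type1 (u : nat -> R) (alpha : R) : lines_below u alpha ->
  (P [set w | exists k, (1 <= k <= n)%N /\ (Sbatch p istar k w > u k)%R]
    <= alpha%:E)%E.
Proof.
move=> lines.
have -> : [set w | exists k, (1 <= k <= n)%N /\ (Sbatch p istar k w > u k)%R] =
    [set w | exists t, (0 < rounds inc t w)%N /\
                       u (rounds inc t w) < gain R inc hd t w].
  apply/seteqP; split => w /=.
    move=> [k [/andP[k1 kn] us]]; exists k.
    by have [-> ->] := rounds_gain k w; rewrite (minn_idPl kn).
  move=> [t]; have [-> ->] := rounds_gain t w => -[t0 us]; exists (minn t n).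
  by rewrite t0 geq_minr.
have mlt : measurable [set r : R | r < 2^-1] by exact: (measurable_itv `]-oo, 2^-1[).
have past0 t : past t set0.
  by split => // i; rewrite set0I; exact: (@measurable0 _ (g_sigma_algebraType _)).
have winE t : (t < n)%N -> wins inc hd t = bit_event t [set r | r < 2^-1].
  by move=> tn; apply/seteqP; split => w; rewrite /wins /inc/= tn.
have lossE t : (t < n)%N -> losses inc hd t = bit_event t (~` [set r | r < 2^-1]).
  by move=> tn; apply/seteqP; split => w; rewrite /losses /inc/= tn => /negP.
have win0 t : (n <= t)%N -> wins inc hd t = set0.
  by move=> nt; apply/seteqP; split => w //; rewrite /wins /inc/= ltnNge nt.
have loss0 t : (n <= t)%N -> losses inc hd t = set0.
  by move=> nt; apply/seteqP; split => w //; rewrite /losses /inc/= ltnNge nt.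
apply: (gain_boundary_le (F := past)) => //.
- by move=> t A [].
- move=> t; split => // i; rewrite setTI.
  by have [] := selection_masked i (geq_minr t n).
- move=> t A pA; have [tn|nt] := ltnP t n; last by rewrite win0// setI0.
  by rewrite winE//; exact: past_bit.
- move=> t A pA; have [tn|nt] := ltnP t n; last by rewrite loss0// setI0.
  by rewrite lossE//; apply: past_bit => //; exact: measurableC.
- move=> t A pA; have [tn|nt] := ltnP t n.
    rewrite (_ : skips inc t = set0) ?setI0//.
    by apply/seteqP; split => w //; rewrite /skips /inc/= tn.
  rewrite (_ : skips inc t = setT) ?setIT; last first.
    by apply/seteqP; split => w //; rewrite /skips /inc/= ltnNge nt.
  by move: pA; rewrite /past/= (minn_idPr nt) (minn_idPr (leqW nt)).
- move=> t A pA; have [tn|nt] := ltnP t n; last by rewrite win0// loss0.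
  (* The event is split by the selected index [j]; each piece is masked for [j], so
     [masked_unfavourable] applies to it. *)
  rewrite winE// lossE// !probability_bit//; last exact: measurableC.
  apply: lee_fsum => [|j _]; first exact: finite_finset.
  have pAj : <<s masked x p j>> (A `&` [set w | istar t.+1 w = j]) by exact: past_selected.
  have := masked_unfavourable mx mp p01 mcp indep pAj.
  rewrite (_ : [set w | _ <= p j w] = p j @^-1` (~` [set r | r < 2^-1])) //.
  by apply/seteqP; split => w /=; rewrite leNgt => /negP.
Qed.

End Batch.

Theorem theorem3 (R : realType) (alpha : R) (u : nat -> R) :
  0 < alpha < 1 ->
  ((exists m : R, 0 < m /\ u = linear_boundary m alpha) \/
   u = curved_boundary alpha) ->
  (* batch version, hypotheses 'I_n, selection steps k = 1..n *)
  (forall (d : measure_display) (T : measurableType d) (P : probability T R)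
          (dX : measure_display) (X : measurableType dX) (n : nat)
          (x : 'I_n -> T -> X) (p : 'I_n -> T -> R),
     (forall i, measurable_fun setT (x i)) ->
     (forall i, measurable_fun setT (p i)) ->
     (forall i w, 0 <= p i w <= 1) ->
     (forall i, mirror_conservative P (p i)) ->
     mutually_independent P
       (fun o : option 'I_n => match o with
                               | None => sigma_family x
                               | Some i => sigmaR (p i) end) ->
     forall istar : nat -> T -> 'I_n,
       (forall k w, (1 <= k <= n)%N -> ~~ inM istar k.-1 w (istar k w)) ->
       (forall k (j : 'I_n), (1 <= k <= n)%N ->
          Fbatch x p istar k.-1 [set w | istar k w = j]) ->
       (P [set w | exists k, (1 <= k <= n)%N /\ (Sbatch p istar k w > u k)%R]
          <= alpha%:E)%E)
  /\
  (* online version, hypotheses indexed by nat (0-based) *)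
  (forall (d : measure_display) (T : measurableType d) (P : probability T R)
          (dX : measure_display) (X : measurableType dX)
          (x : nat -> T -> X) (p : nat -> T -> R),
     (forall i, measurable_fun setT (x i)) ->
     (forall i, measurable_fun setT (p i)) ->
     (forall i w, 0 <= p i w <= 1) ->
     (forall i, mirror_conservative P (p i)) ->
     mutually_independent P
       (fun o : option nat => match o with
                              | None => sigma_family x
                              | Some i => sigmaR (p i) end) ->
     forall incl : nat -> T -> bool,
       (forall t, Fonline x p t [set w | incl t w]) ->
       (P [set w | exists t, (0 < Konline incl t w)%N /\
                             (Sonline p incl t w > u (Konline incl t w))%R]
          <= alpha%:E)%E).
Proof.
move=> a01 u_shape; have lines : lines_below u alpha.
  case: u_shape => [[m [m0 ->]]|->]; first exact: linear_boundary_lines.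
  exact: curved_boundary_lines.
split.
- move=> d T P dX X n x p mx mp p01 mcp indep istar istar_new mistar.
  exact: (batch_type1 mx mp p01 mcp indep istar_new mistar).
- move=> d T P dX X x p mx mp p01 mcp indep incl mincl.
  exact: (online_type1 mx mp p01 mcp indep mincl).
Qed.
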